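(* Let $\mathrm{cl}_1$ and $\mathrm{cl}_2$ be closure operators on disjoint finite sets $V_1$ and $V_2$ of cardinalities $n_1$ and $n_2$, with ranks $r_1$ and $r_2$ respectively, and suppose $n_1-r_1\ge n_2-r_2$. Let $A$ be a finite alphabet with $|A|\ge2$. Then each of the following properties implies the next: (a) $\mathrm{cl}_1$ and $\mathrm{cl}_2$ are solvable over $A$; (b) $\mathrm{cl}_1$ is solvable over $A$ and $b(\mathrm{cl}_2,A)\le n_1-r_1$; (c) the bidirectional union $\mathrm{cl}_1\,\bar{\cup}\,\mathrm{cl}_2$ is solvable over $A$; (d) $\mathrm{cl}_1$ is solvable over $A$ and $g(\mathrm{cl}_2,A)\ge n_2-n_1+r_1$. In particular, if $n_1-r_1=n_2-r_2$, then $\mathrm{cl}_1\,\bar{\cup}\,\mathrm{cl}_2$ is solvable over $A$ if and only if $\mathrm{cl}_1$ and $\mathrm{cl}_2$ are solvable over $A$.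
   Context: Bidirectional union: with $V=V_1\cup V_2$ and $X_i=X\cap V_i$ for $X\subseteq V$, $\mathrm{cl}_1\,\bar{\cup}\,\mathrm{cl}_2$ is the closure operator on $V$ given by $(\mathrm{cl}_1\,\bar{\cup}\,\mathrm{cl}_2)(X)=V_1\cup\mathrm{cl}_2(X_2)$ if $X_1=V_1$; $=\mathrm{cl}_1(X_1)\cup V_2$ if $X_2=V_2$; and $=X_1\cup X_2$ otherwise. For a closure operator $\mathrm{cl}$ on a finite set $W$ with $|W|=n$, the rank is $r=\min\{|b|: b\subseteq W,\ \mathrm{cl}(b)=W\}$. For a family $f=(f_v)_{v\in W}$ of partitions of $A^r$, $f_X$ ($X\subseteq W$) denotes the common refinement of the $f_v$, $v\in X$ (parts are the nonempty intersections of parts; $f_\emptyset$ has one part). A coding function for $\mathrm{cl}$ over $A$ is a family $f=(f_v)_{v\in W}$ of partitions of $A^r$, each into at most $|A|$ parts, such that $f_X=f_{\mathrm{cl}(X)}$ for all $X\subseteq W$. $\mathrm{cl}$ is solvable over $A$ if it has a coding function $f$ such that $f_W$ is the partition of $A^r$ into singletons. The parts of each $f_v$ are labelled by $A$: $f_v=\{P_a(f_v):a\in A\}$, some possibly empty. For $x\in A^n$ (coordinates indexed by $W$) put $P_x(f_W)=\bigcap_{v\in W}P_{x_v}(f_v)$ and $\mathrm{Im}(f)=\{x\in A^n: P_x(f_W)\neq\emptyset\}$. The guessing number is $g(\mathrm{cl},A)=\max\{\log_{|A|}|\mathrm{Im}(f)|: f\text{ coding function for }\mathrm{cl}\text{ over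 }A\}$. The solvability graph $\mathrm{G}(\mathrm{cl},A)$ is the undirected graph on $A^n$ in which $x,y$ are adjacent if and only if no coding function $f$ for $\mathrm{cl}$ over $A$ has $x,y\in\mathrm{Im}(f)$; and $b(\mathrm{cl},A)=\log_{|A|}\chi(\mathrm{G}(\mathrm{cl},A))$, where $\chi$ is the chromatic number. *)

(* Defs.v *)
From HB Require Import structures.
From mathcomp Require Import all_boot all_order all_algebra.
From mathcomp Require Import reals exp.

Set Implicit Arguments.
Unset Strict Implicit.
Unset Printing Implicit Defensive.

Import Order.TTheory GRing.Theory Num.Theory.
Local Open Scope ring_scope.

Definition closure_operator (W : finType) (cl : {set W} -> {set W}) : Prop :=
  [/\ forall X : {set W}, X \subset cl X,
      forall X Y : {set W}, X \subset Y -> cl X \subset cl Y &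
      forall X : {set W}, cl (cl X) = cl X].

(* The default value #|W| of the minimum is attained at b = W, because
   cl W = W for every closure operator. *)
Definition rank (W : finType) (cl : {set W} -> {set W}) : nat :=
  \big[minn/#|W|]_(b : {set W} | cl b == [set: W]) #|b|.

(* The disjoint union of the ground sets V1 and V2 is the sum type V1 + V2. *)
Definition bidirectional_union (V1 V2 : finType)
    (cl1 : {set V1} -> {set V1}) (cl2 : {set V2} -> {set V2})
    (X : {set V1 + V2}) : {set V1 + V2} :=
  let X1 := inl @^-1: X in
  let X2 := inr @^-1: X in
  if X1 == [set: V1] then inl @: [set: V1] :|: inr @: cl2 X2
  else if X2 == [set: V2] then inl @: cl1 X1 :|: inr @: [set: V2]
  else inl @: X1 :|: inr @: X2.

(* The common refinement f_X: the parts are the nonempty intersections of one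
   part Q v of each f v with v in X (the values of Q outside X are not used);
   for X empty the intersection is the whole of B. *)
Definition refinement (W B : finType) (f : {ffun W -> {set {set B}}})
    (X : {set W}) : {set {set B}} :=
  [set \bigcap_(v in X) Q v
     | Q : {ffun W -> {set B}} & [forall (v | v \in X), Q v \in f v]] :\ set0.

Definition coding_function (W : finType) (cl : {set W} -> {set W})
    (A : finType) (f : {ffun W -> {set {set (rank cl).-tuple A}}}) : bool :=
  [forall v, partition (f v) [set: (rank cl).-tuple A] && (#|f v| <= #|A|)%N]
  && [forall X : {set W}, refinement f X == refinement f (cl X)].
Arguments coding_function {W} cl {A} f.

Definition solvable_over (W : finType) (cl : {set W} -> {set W})
    (A : finType) : Prop :=
  exists f : {ffun W -> {set {set (rank cl).-tuple A}}},
    coding_function cl f /\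
    refinement f [set: W] = [set [set z] | z : (rank cl).-tuple A].

(* P labels the parts of f by A: P v a is the part of f v with label a, or is
   empty if the label a is not used. Disjointness makes each part carry exactly
   one label. *)
Definition labelling (W A B : finType) (f : {ffun W -> {set {set B}}})
    (P : {ffun W -> {ffun A -> {set B}}}) : bool :=
  [forall v, (f v == [set P v a | a : A] :\ set0)
     && [forall a, forall a', (a != a') ==> [disjoint P v a & P v a']]].

Definition Im (W A B : finType) (P : {ffun W -> {ffun A -> {set B}}}) :
    {set {ffun W -> A}} :=
  [set x : {ffun W -> A} | \bigcap_(v : W) P v (x v) != set0].

Definition log (R : realType) (q k : nat) : R := ln (k%:R : R) / ln (q%:R : R).

(* The maximum is over the coding functions f together with a labelling P of
   their parts. Im P is nonempty, so for #|A| > 1 all the logarithms are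
   nonnegative, and the one-part partitions form a coding function; hence the
   default value 0 does not affect the maximum. *)
Definition guessing_number (R : realType) (W : finType)
    (cl : {set W} -> {set W}) (A : finType) : R :=
  \big[Num.max/0]_(fP : {ffun W -> {set {set (rank cl).-tuple A}}} *
                        {ffun W -> {ffun A -> {set (rank cl).-tuple A}}}
                   | coding_function cl fP.1 && labelling fP.1 fP.2)
     log R #|A| #|Im fP.2|.

Definition solvability_graph (W : finType) (cl : {set W} -> {set W})
    (A : finType) : rel {ffun W -> A} :=
  fun x y =>
    ~~ [exists f : {ffun W -> {set {set (rank cl).-tuple A}}},
        exists P : {ffun W -> {ffun A -> {set (rank cl).-tuple A}}},
        [&& coding_function cl f, labelling f P, x \in Im P & y \in Im P]].

(* A graph without loops always has a proper colouring with #|T| colours, so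
   the default value #|T| of the minimum is correct. The solvability graph has
   no loops: any x lies in Im P for some labelling P of the one-part
   partitions. *)
Definition chromatic_number (T : finType) (e : rel T) : nat :=
  \big[minn/#|T|]_(k < #|T| | [exists c : {ffun T -> 'I_k},
     [forall x, forall y, e x y ==> (c x != c y)]]) k.

Definition log_chromatic_number (R : realType) (W : finType)
    (cl : {set W} -> {set W}) (A : finType) : R :=
  log R #|A| (chromatic_number (solvability_graph cl (A := A))).

(* Main.v *)
Require Import Defs.
From HB Require Import structures.
From mathcomp Require Import all_boot all_order all_algebra.
From mathcomp Require Import reals exp.
From mathcomp Require Import lra zify.

Set Implicit Arguments.
Unset Strict Implicit.
Unset Printing Implicit Defensive.

Import Order.TTheory GRing.Theory Num.Theory.
Local Open Scope ring_scope.

(* The images of the coding functions for cl are exactly the nonempty sets of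
   words in which any two words agree on a closed set of coordinates, that is,
   the independent sets of the solvability graph. Such a set has at most q^r
   words, q = |A|, since a word is determined by its restriction to a basis,
   and cl is solvable iff q^r is attained. The solvability graph of the
   bidirectional union is the Cartesian product of the two solvability graphs.

   If cl is solvable, then A^n is tiled by q^(n - r) translates of a maximum
   independent set, whence b(cl, A) = n - r: this is (a) => (b). Given proper
   colourings c1, c2 of the two graphs with the same q^(n1 - r1) colours, the
   classes of c1 all have size q^r1 by counting, and {(x, y) | c1 x = c2 y} is
   an independent set of size q^(n2 + r1) of the product: (b) => (c).
   Conversely, in an independent set of that size the fibres over A^n2 all have
   the maximal size q^r1, and some fibre over A^n1 has at least the
   average size q^(n2 + r1 - n1): (c) => (d). *)

(** * Agreement sets and compatible sets of words *)

Definition agree (W A : finType) (x y : {ffun W -> A}) : {set W} :=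
  [set v | x v == y v].

(** For extensive [cl] the inclusion means that [agree x y] is closed. *)
Definition compatible (W : finType) (cl : {set W} -> {set W}) (A : finType)
    (S : {set {ffun W -> A}}) : Prop :=
  {in S &, forall x y, cl (agree x y) \subset agree x y}.

Lemma closure_operator_setT (W : finType) (cl : {set W} -> {set W}) :
  closure_operator cl -> cl [set: W] = [set: W].
Proof. by case=> ext _ _; apply/eqP; rewrite eqEsubset subsetT ext. Qed.

(** * Minima over finite families, and bases *)

Lemma bigminn_le_cond (I : eqType) (d : nat) (r : seq I) (P : pred I)
    (F : I -> nat) (i : I) :
  i \in r -> P i -> (\big[minn/d]_(j <- r | P j) F j <= F i)%N.
Proof.
elim: r => // j r IHr; rewrite inE big_cons => /orP[/eqP<- ->|ir Pi].
  exact: geq_minl.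
by case: ifP => _; last exact: IHr; rewrite geq_min IHr ?orbT.
Qed.

Lemma bigminn_le_idx (I : Type) (d : nat) (r : seq I) (P : pred I)
    (F : I -> nat) :
  (\big[minn/d]_(j <- r | P j) F j <= d)%N.
Proof.
elim: r => [|j r IHr]; first by rewrite big_nil.
by rewrite big_cons; case: ifP => // _; rewrite geq_min IHr orbT.
Qed.

Section Rank.
Variables (W : finType) (cl : {set W} -> {set W}).

Lemma rank_le_card (b : {set W}) : cl b = [set: W] -> (rank cl <= #|b|)%N.
Proof.
by move=> clb; rewrite bigminn_le_cond ?clb ?mem_index_enum.
Qed.

Lemma rank_basis : closure_operator cl ->
  exists2 b : {set W}, cl b = [set: W] & #|b| = rank cl.
Proof.
move=> hcl; rewrite /rank.
elim/big_ind: _ => [|m n [b clb <-] [c clc <-]|b /eqP clb]; last by exists b.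
  by exists [set: W]; [exact: closure_operator_setT | rewrite cardsT].
by have [|] := leqP #|b| #|c|; [exists b | exists c].
Qed.

Lemma rank_le : (rank cl <= #|W|)%N.
Proof. exact: bigminn_le_idx. Qed.

End Rank.

(** * Labelled partitions and their images *)

Section Labelling.
Variables (W A B : finType).
Implicit Types (f : {ffun W -> {set {set B}}})
  (P : {ffun W -> {ffun A -> {set B}}}).

Lemma labelling_part f P v Q z :
  labelling f P -> Q \in f v -> z \in Q -> exists a, Q = P v a.
Proof.
move=> /forallP/(_ v)/andP[/eqP-> _] /setD1P[_ /imsetP[a _ ->]] _.
by exists a.
Qed.

Lemma labelling_mem f P v a z :
  labelling f P -> z \in P v a -> P v a \in f v.
Proof.
move=> /forallP/(_ v)/andP[/eqP-> _] zP; rewrite !inE imset_f // andbT.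
by apply/set0Pn; exists z.
Qed.

Lemma labelling_inj f P v a a' z :
  labelling f P -> z \in P v a -> z \in P v a' -> a = a'.
Proof.
move=> /forallP/(_ v)/andP[_ /forallP/(_ a)/forallP/(_ a')].
move=> /implyP dis za za'; apply/eqP/negPn/negP=> /dis.
by move/disjoint_setI0/setP/(_ z); rewrite !inE za za'.
Qed.

Lemma ImP P (x : {ffun W -> A}) :
  reflect (exists z, forall v, z \in P v (x v)) (x \in Defs.Im P).
Proof.
rewrite inE; apply: (iffP (set0Pn _)) => -[z zP]; exists z.
  by move=> v; move/bigcapP: zP; apply.
by apply/bigcapP=> v _.
Qed.

Lemma mem_refinement f P (X : {set W}) (x : {ffun W -> A}) z :
    labelling f P -> (forall v, z \in P v (x v)) ->
  \bigcap_(v in X) P v (x v) \in refinement f X.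
Proof.
move=> lfP zP; rewrite !inE; apply/andP; split.
  by apply/set0Pn; exists z; apply/bigcapP.
apply/imsetP; exists [ffun v => P v (x v)].
  rewrite inE; apply/forall_inP=> v _; rewrite ffunE.
  exact: labelling_mem (zP v).
by apply: eq_bigr => v _; rewrite ffunE.
Qed.

Lemma labelling_exists f : (forall v, #|f v| <= #|A|)%N ->
    (forall v, set0 \notin f v) -> (forall v, trivIset (f v)) ->
  exists P, labelling f P.
Proof.
move=> lefA f0 trf.
(* The part listed at position i gets the letter of rank i; letters beyond the last part get the
   default [set0]. *)
exists [ffun v => [ffun a => nth set0 (enum (f v)) (enum_rank a)]].
have nth0 v a : (size (enum (f v)) <= enum_rank a)%N ->
  nth set0 (enum (f v)) (enum_rank a) = set0 by move=> ?; rewrite nth_default.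
apply/forallP=> v; apply/andP; split.
  apply/eqP/setP=> Q; rewrite !inE; apply/idP/idP=> [fQ|].
    rewrite (memPn (f0 v)) //=; apply/imsetP.
    have ltQ : (index Q (enum (f v)) < #|A|)%N.
      by rewrite (leq_trans _ (lefA v)) // cardE index_mem mem_enum.
    exists (enum_val (Ordinal ltQ)) => //.
    by rewrite !ffunE enum_valK /= nth_index // mem_enum.
  case/andP=> Q0 /imsetP[a _ defQ]; move: Q0; rewrite defQ !ffunE => Q0.
  by rewrite -mem_enum mem_nth // ltnNge; apply: contraNN Q0 => /nth0/eqP.
apply/forallP=> a; apply/forallP=> a'; apply/implyP=> neq.
rewrite !ffunE.
have [/nth0->|lta] := leqP (size (enum (f v))) (enum_rank a).
  by rewrite disjoint_sym disjoints_subset setC0 subsetT.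
have [/nth0->|lta'] := leqP (size (enum (f v))) (enum_rank a').
  by rewrite disjoints_subset setC0 subsetT.
have memf i : (i < size (enum (f v)))%N -> nth set0 (enum (f v)) i \in f v.
  by move=> lti; rewrite -mem_enum mem_nth.
have /trivIsetP := trf v; apply; rewrite ?memf //.
rewrite nth_uniq ?enum_uniq //.
by apply: contraNneq neq => /ord_inj/enum_rank_inj->.
Qed.

End Labelling.

(** If [z] codes [x] and [z'] codes [y], both points lie in one part of the refinement over
    [agree x y]. That part is also a part of the refinement over the closure, so the labels of [z]
    and [z'] coincide there. *)
Lemma coding_function_compatible (W A : finType) (cl : {set W} -> {set W})
    (f : {ffun W -> {set {set (rank cl).-tuple A}}})
    (P : {ffun W -> {ffun A -> {set (rank cl).-tuple A}}}) :
  coding_function cl f -> labelling f P -> compatible cl (Defs.Im P).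
Proof.
move=> /andP[_ /forallP cf] lfP x y /ImP[z zx] /ImP[z' zy].
have:= mem_refinement (agree x y) lfP zx.
rewrite (eqP (cf _)) => /setD1P[_ /imsetP[Q]].
rewrite inE => /forall_inP fQ eqQ.
have mem t : (forall v, v \in agree x y -> t \in P v (x v)) ->
    forall v, v \in cl (agree x y) -> t \in Q v.
  move=> tP; apply/bigcapP; rewrite -eqQ; exact/bigcapP.
have zQ := mem z (fun v _ => zx v).
have {mem} z'Q := mem z' (fun v => ltac:(by rewrite inE => /eqP->)).
apply/subsetP=> v vX; rewrite inE; apply/eqP.
have [a defQ] := labelling_part lfP (fQ v vX) (zQ v vX).
move: (zQ v vX) (z'Q v vX); rewrite defQ => za za'.
by rewrite (labelling_inj lfP (zx v) za) (labelling_inj lfP (zy v) za').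
Qed.

Lemma coding_function_label (W A : finType) (cl : {set W} -> {set W})
    (f : {ffun W -> {set {set (rank cl).-tuple A}}})
    (P : {ffun W -> {ffun A -> {set (rank cl).-tuple A}}}) z :
  coding_function cl f -> labelling f P ->
  exists x : {ffun W -> A}, forall v, z \in P v (x v).
Proof.
move=> /andP[/forallP part _] lfP.
have label v : exists a, z \in P v a.
  have /andP[/and3P[/eqP cov _ _] _] := part v.
  have /bigcupP[Q fQ zQ] : z \in cover (f v) by rewrite cov inE.
  by have [a defQ] := labelling_part lfP fQ zQ; exists a; rewrite -defQ.
exists [ffun v => xchoose (label v)] => v.
by rewrite ffunE; apply: (xchooseP (label v)).
Qed.

(** * Coding functions induced by maps into words *)

Section FunctionCoding.
Variables (W A B : finType) (h : B -> {ffun W -> A}).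

Definition fun_labels : {ffun W -> {ffun A -> {set B}}} :=
  [ffun v => [ffun a => [set z | h z v == a]]].

Definition fun_parts : {ffun W -> {set {set B}}} :=
  [ffun v => [set fun_labels v a | a : A] :\ set0].

Lemma labelling_fun : labelling fun_parts fun_labels.
Proof.
apply/forallP=> v; rewrite ffunE eqxx /=.
apply/forallP=> a; apply/forallP=> a'; apply/implyP=> neq.
rewrite !ffunE -setI_eq0; apply/eqP/setP=> z; rewrite !inE.
by case: eqP => //= ->; apply: negbTE.
Qed.

Lemma Im_fun : Defs.Im fun_labels = [set h z | z : B].
Proof.
apply/setP=> x; apply/ImP/imsetP=> [[z zx]|[z _ ->]].
  by exists z => //; apply/ffunP=> v; have:= zx v; rewrite !ffunE inE => /eqP.
by exists z => v; rewrite !ffunE inE.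
Qed.

Lemma partition_fun v : partition (fun_parts v) [set: B].
Proof.
have memh z : [set z' | h z' v == h z v] \in fun_parts v.
  have:= labelling_mem (v := v) (a := h z v) (z := z) labelling_fun.
  by rewrite !ffunE; apply; rewrite inE.
apply/and3P; split; last by rewrite ffunE !inE eqxx.
  apply/eqP/setP=> z; rewrite inE; apply/bigcupP.
  by exists [set z' | h z' v == h z v]; rewrite ?inE.
apply/trivIsetP=> Q Q'; rewrite ffunE => /setD1P[_ /imsetP[a _ ->]].
move=> /setD1P[_ /imsetP[a' _ ->]] neq.
have /forallP/(_ v)/andP[_ /forallP/(_ a)/forallP/(_ a')/implyP] :=
  labelling_fun.
by apply; apply: contraNneq neq => ->.
Qed.

Lemma card_fun_parts v : (#|fun_parts v| <= #|A|)%N.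
Proof.
rewrite ffunE; apply: leq_trans (subset_leq_card (subsetDl _ _)) _.
by rewrite (leq_trans (leq_imset_card _ _)) ?max_card.
Qed.

(** A nonempty intersection of parts is determined by any of its points [z], since each part used is
    then the one labelled [h z v]. *)
Lemma refinement_fun (X : {set W}) :
  refinement fun_parts X =
    [set [set z' | X \subset agree (h z') (h z)] | z : B].
Proof.
have bcapE z : \bigcap_(v in X) fun_labels v (h z v) =
    [set z' | X \subset agree (h z') (h z)].
  apply/setP=> z'; rewrite inE; apply/bigcapP/subsetP=> sub v /sub;
  by rewrite !ffunE !inE.
apply/setP=> p; apply/idP/imsetP=> [/setD1P[/set0Pn[z]]|[z _ ->]].
  move=> + /imsetP[Q]; rewrite inE => + /forall_inP fQ defp.
  rewrite {}defp => /bigcapP zQ; exists z => //.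
  rewrite -bcapE; apply: eq_bigr => v vX.
  have [a defQ] := labelling_part labelling_fun (fQ v vX) (zQ v vX).
  by have:= zQ v vX; rewrite defQ !ffunE inE => /eqP->.
rewrite -bcapE; apply: mem_refinement labelling_fun _ => v.
by rewrite !ffunE inE.
Qed.

End FunctionCoding.

(** Agreement sets of images are closed, so they contain [X] exactly when they contain [cl X]; hence
    [X] and [cl X] have the same refinement. *)
Lemma coding_function_fun (W A : finType) (cl : {set W} -> {set W})
    (h : (rank cl).-tuple A -> {ffun W -> A}) :
  closure_operator cl -> compatible cl [set h z | z : _] ->
  coding_function cl (fun_parts h).
Proof.
case=> ext mono _ compat; apply/andP; split.
  by apply/forallP=> v; rewrite partition_fun card_fun_parts.
apply/forallP=> X; rewrite !refinement_fun; apply/eqP/eq_imset=> z.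
apply/setP=> z'; rewrite !inE; apply/idP/idP; last exact: subset_trans.
move=> /mono/subset_trans; apply; apply: compat; exact: imset_f.
Qed.

(** * Compatible sets as images, and solvability as extremality *)

Section Compatible.
Variables (W A : finType) (cl : {set W} -> {set W}).
Hypothesis hcl : closure_operator cl.
Implicit Types (S : {set {ffun W -> A}}) (x y : {ffun W -> A}).

Lemma compatible_inj S (b : {set W}) : compatible cl S -> cl b = [set: W] ->
  {in S &, forall x y, b \subset agree x y -> x = y}.
Proof.
case: hcl => _ mono _ cS clb x y xS yS /mono; rewrite clb => sub.
apply/ffunP=> v; apply/eqP; have:= subsetP (cS _ _ xS yS) v.
by rewrite inE; apply; rewrite (subsetP sub).
Qed.

Definition restr (b : {set W}) x : {ffun {v | v \in b} -> A} :=
  [ffun v => x (val v)].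

Lemma restr_eqP b x y : reflect (restr b x = restr b y) (b \subset agree x y).
Proof.
apply: (iffP subsetP) => [sub|/ffunP eqxy v vb].
  apply/ffunP=> -[v vb]; rewrite !ffunE.
  by have:= sub v vb; rewrite inE => /eqP.
by rewrite inE; have:= eqxy (Sub v vb); rewrite !ffunE /= => ->.
Qed.

Lemma card_restr (b : {set W}) :
  #|{: {ffun {v | v \in b} -> A}}| = (#|A| ^ #|b|)%N.
Proof. by rewrite card_ffun card_sig. Qed.

Lemma restr_inj S b : compatible cl S -> cl b = [set: W] ->
  {in S &, injective (restr b)}.
Proof.
move=> cS clb x y xS yS /restr_eqP.
exact: compatible_inj cS clb _ _ xS yS.
Qed.

Lemma compatible_card S : compatible cl S -> (#|S| <= #|A| ^ rank cl)%N.
Proof.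
move=> cS; have [b clb <-] := rank_basis hcl.
by rewrite -card_restr -(card_in_imset (restr_inj cS clb)) max_card.
Qed.

Lemma compatible1 x : compatible cl [set x].
Proof.
move=> _ _ /set1P-> /set1P->; suff ->: agree x x = [set: W] by exact: subsetT.
by apply/setP=> v; rewrite !inE eqxx.
Qed.

(** Converse of [coding_function_compatible]: the bound q^r on the size of [S] leaves enough points
    of A^r to enumerate [S]. *)
Lemma compatible_coding S : compatible cl S -> S != set0 ->
  exists h : (rank cl).-tuple A -> {ffun W -> A},
  [/\ coding_function cl (fun_parts h), [set h z | z : _] = S &
      #|S| = (#|A| ^ rank cl)%N -> injective h].
Proof.
move=> cS /set0Pn[x0 x0S].
(* Points ranked beyond the size of [S] are all sent to [x0]; there are none when [S] has q^r words,
   which makes [h] injective. *)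
pose h z := nth x0 (enum S) (@enum_rank {: (rank cl).-tuple A} z).
have leS : (#|S| <= #|{: (rank cl).-tuple A}|)%N.
  by rewrite card_tuple compatible_card.
have hS : [set h z | z : _] = S.
  apply/setP=> x; apply/imsetP/idP=> [[z _ ->]|xS].
    rewrite /h; have [le|lt] := leqP (size (enum S)) (enum_rank z).
      by rewrite nth_default.
    by rewrite -mem_enum mem_nth.
  have ltx : (index x (enum S) < #|{: (rank cl).-tuple A}|)%N.
    by rewrite (leq_trans _ leS) // cardE index_mem mem_enum.
  exists (enum_val (Ordinal ltx)) => //.
  by rewrite /h enum_valK /= nth_index ?mem_enum.
exists h; split=> //; first by apply: coding_function_fun; rewrite ?hS.
move=> eqS z z' /eqP; rewrite nth_uniq ?enum_uniq -?cardE ?eqS -?card_tuple //.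
by move=> /eqP/ord_inj/enum_rank_inj.
Qed.

(** Two words lie in a common image iff the pair they form is compatible; the agreement set of a
    word with itself is everything, so only [agree x y] matters. *)
Lemma solvability_graphE x y :
  solvability_graph cl x y = ~~ (cl (agree x y) \subset agree x y).
Proof.
congr negb; apply/existsP/idP=> [[f /existsP[P]]|].
  case/and4P=> cf lfP xP yP; exact: (coding_function_compatible cf lfP).
move=> sub; have [||h [cf hS _]] := @compatible_coding [set x; y].
- have agreeC : agree y x = agree x y by apply/setP=> v; rewrite !inE eq_sym.
  have agrxx (t : {ffun W -> A}) : cl (agree t t) \subset agree t t.
    exact: (@compatible1 t _ _ (set11 t) (set11 t)).
  by move=> _ _ /set2P[]-> /set2P[]->; rewrite ?agreeC.
- by apply/set0Pn; exists x; rewrite !inE eqxx.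
exists (fun_parts h); apply/existsP; exists (fun_labels h).
by rewrite cf labelling_fun Im_fun hS !inE !eqxx orbT.
Qed.

Lemma solvableP : (0 < #|A|)%N ->
  solvable_over cl A <->
  exists2 S : {set {ffun W -> A}}, compatible cl S & #|S| = (#|A| ^ rank cl)%N.
Proof.
move=> A_gt0; split=> [[f [cf f1]]|[S cS eqS]].
  have /andP[/forallP part _] := cf.
  have [P lfP] : exists P : {ffun W -> {ffun A -> _}}, labelling f P.
    by apply: labelling_exists => v; case/andP: (part v) => [/and3P[]].
  have [x xP] := fin_all_exists (fun z => coding_function_label z cf lfP).
  exists (Defs.Im P); first exact: coding_function_compatible cf lfP.
  apply/eqP; rewrite eqn_leq compatible_card /=; last first.
    exact: coding_function_compatible cf lfP.
  (* Points coded by the same word lie in the same part of the full refinement, and those parts are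
     singletons. *)
  have inj_x : injective x.
    move=> z z' eqx; have:= mem_refinement setT lfP (xP z).
    rewrite f1 => /imsetP[t _ eqt].
    have mem u : (forall v, u \in P v (x z v)) -> u = t.
      by move=> uP; apply/set1P; rewrite -eqt; apply/bigcapP.
    by rewrite (mem z (xP z)); apply/esym/mem; rewrite eqx; apply: xP.
  rewrite -card_tuple -(card_imset _ inj_x); apply/subset_leq_card/subsetP.
  by move=> _ /imsetP[z _ ->]; apply/ImP; exists z.
have S0 : S != set0 by rewrite -card_gt0 eqS expn_gt0 A_gt0.
have [h [cf hS /(_ eqS) inj_h]] := compatible_coding cS S0.
(* The parts of the full refinement are the fibres of [h], which is injective. *)
exists (fun_parts h); split=> //; rewrite refinement_fun.
apply: eq_imset => z; apply/setP=> z'; rewrite !inE.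
apply/subsetP/eqP=> [sub|-> v _]; last by rewrite inE.
by apply/inj_h/ffunP=> v; apply/eqP; have:= sub v; rewrite !inE; apply.
Qed.

End Compatible.

(** * Colourings of finite graphs *)

Lemma chromatic_number_le (T K : finType) (e : rel T) (c : T -> K) :
  (forall x y, e x y -> c x != c y) -> (chromatic_number e <= #|K|)%N.
Proof.
(* The minimum ranges over [k < #|T|] only; larger palettes are covered by its default value. *)
move=> cP; have [ltK|leT] := ltnP #|K| #|T|; last first.
  exact: leq_trans (bigminn_le_idx _ _ _ _) leT.
apply: (bigminn_le_cond _ _ (mem_index_enum (Ordinal ltK))).
apply/existsP; exists [ffun x => enum_rank (c x)].
apply/forallP=> x; apply/forallP=> y; apply/implyP=> /cP; rewrite !ffunE.
by apply: contraNneq => /enum_rank_inj->.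
Qed.

Lemma chromatic_number_colouring (T : finType) (e : rel T) :
  irreflexive e ->
  exists c : T -> 'I_(chromatic_number e), forall x y, e x y -> c x != c y.
Proof.
move=> irr; rewrite /chromatic_number.
elim/big_ind: _ => [|m n cm cn|k /existsP[c /forallP cP]].
(* The default value is realised by giving every vertex its own colour, which is proper because
   there are no loops. *)
- exists enum_rank => x y exy; apply: contraTneq exy => /enum_rank_inj->.
  by rewrite irr.
- by have [] := leqP m n.
- by exists c => x y; have /forallP/(_ y)/implyP := cP x.
Qed.

(** Addition modulo [#|A|], transported to the alphabet; it will compare a letter with a reference
    letter. *)
Lemma latin_square (A : finType) : (0 < #|A|)%N ->
  exists d : A -> A -> A,
    (forall a, injective (d a)) /\ (forall b, injective (d^~ b)).
Proof.
move=> A_gt0; have eqA : #|A| = #|A|.-1.+1 by rewrite prednK.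
pose e (a : A) := cast_ord eqA (enum_rank a).
have inj_e : injective e by move=> a b /cast_ord_inj/enum_rank_inj.
pose e' i : A := enum_val (cast_ord (esym eqA) i).
have inj_e' : injective e' by move=> i j /enum_val_inj/cast_ord_inj.
exists (fun a b => e' (e a + e b)); split=> [a b c|a b c].
  by move/inj_e'/addrI/inj_e.
by move/inj_e'/addIr/inj_e.
Qed.

(** * Proper colourings of the solvability graph, and counting *)

(** Contrapositive form of properness: each colour class is a compatible set. *)
Definition proper (W A K : finType) (cl : {set W} -> {set W})
    (c : {ffun W -> A} -> K) : Prop :=
  forall x y, c x = c y -> cl (agree x y) \subset agree x y.

Lemma sum_nat_eq_bound (I : finType) (F : I -> nat) (m : nat) :
  (forall i, F i <= m)%N -> (\sum_i F i = #|I| * m)%N -> forall i, F i = m.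
Proof.
move=> leF eqF i; apply/eqP; rewrite eqn_leq leF /= leqNgt; apply/negP=> ltF.
suff: (\sum_j F j < #|I| * m)%N by rewrite eqF ltnn.
rewrite -sum_nat_const (bigD1 i) // [ltnRHS](bigD1 i) //= -addSn.
by rewrite leq_add // leq_sum.
Qed.

Lemma sum_fibres (T K : finType) (c : T -> K) :
  (\sum_k #|[set x | c x == k]| = #|T|)%N.
Proof.
rewrite -sum1_card (partition_big c predT) //=; apply: eq_bigr => k _.
by rewrite sum1_card cardsE.
Qed.

Lemma proper_compatible (W A K : finType) (cl : {set W} -> {set W})
    (c : {ffun W -> A} -> K) (k : K) :
  proper cl c -> compatible cl [set x | c x == k].
Proof.
by move=> cP x y; rewrite !inE => /eqP cx /eqP cy; apply: cP; rewrite cx.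
Qed.

(** The q^(n - r) classes have at most q^r words each and cover all q^n words, so every bound is
    attained. *)
Lemma proper_fibre_card (W A K : finType) (cl : {set W} -> {set W})
    (c : {ffun W -> A} -> K) :
  closure_operator cl -> #|K| = (#|A| ^ (#|W| - rank cl))%N -> proper cl c ->
  forall k, #|[set x | c x == k]| = (#|A| ^ rank cl)%N.
Proof.
move=> hcl eqK cP; apply: sum_nat_eq_bound => [k|].
  by apply: (compatible_card hcl); apply: proper_compatible.
by rewrite sum_fibres eqK card_ffun -expnD subnK // rank_le.
Qed.

(* The colour of x records, off a basis b, how x differs from the codeword
   that agrees with x on b. *)
Lemma solvable_proper (W A : finType) (cl : {set W} -> {set W}) :
    closure_operator cl -> (0 < #|A|)%N -> solvable_over cl A ->
  exists (K : finType) (c : {ffun W -> A} -> K),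
    #|K| = (#|A| ^ (#|W| - rank cl))%N /\ proper cl c.
Proof.
move=> hcl A_gt0 /(solvableP hcl A_gt0)[S cS eqS].
have [b clb cardb] := rank_basis hcl.
have [d [d1 d2]] := latin_square A_gt0.
(* Restriction to [b] is injective on [S] and [S] has q^r words, so every pattern on [b] extends to
   a codeword. *)
have ex_s x : exists2 t, t \in S & restr b t = restr b x.
  have full : [set restr b t | t in S] = [set: _].
    apply/eqP; rewrite eqEcard subsetT cardsT.
    by rewrite (card_in_imset (restr_inj hcl cS clb)) card_restr cardb eqS /=.
  have: restr b x \in [set restr b t | t in S] by rewrite full inE.
  by case/imsetP=> t tS ->; exists t.
have [s sS /= sx] := fin_all_exists2 ex_s.
have {}sx x v : v \in b -> s x v = x v.
  have /restr_eqP/subsetP sub := sx x.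
  by move=> /sub; rewrite inE => /eqP.
exists {ffun {v | v \in ~: b} -> A}.
exists (fun x : {ffun W -> A} => [ffun u => d (x (val u)) (s x (val u))]).
split.
  by rewrite card_restr -cardb -(cardsC b) addKn.
(* On [b] the words equal their codewords; off [b], equal colours and cancellation on either side of
   [d] make [x] and [y] agree exactly where their codewords do. *)
move=> x y /ffunP eqc; suff ->: agree x y = agree (s x) (s y) by apply: cS.
apply/setP=> v; rewrite !inE; have [vb|vb] := boolP (v \in b).
  by rewrite !sx.
have vCb : v \in ~: b by rewrite inE.
have := eqc (Sub v vCb); rewrite !ffunE /= => eqd.
by apply/eqP/eqP=> eqv; move: eqd; rewrite eqv; [move/d1 | move/d2].
Qed.

Lemma solvability_graph_irr (W A : finType) (cl : {set W} -> {set W}) :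
  closure_operator cl -> irreflexive (solvability_graph cl (A := A)).
Proof.
move=> hcl x; rewrite solvability_graphE //; apply/negbTE/negPn.
exact: (compatible1 cl (set11 x) (set11 x)).
Qed.

Lemma chromatic_number_proper (W A : finType) (cl : {set W} -> {set W})
    (m : nat) : closure_operator cl ->
  (exists (K : finType) (c : {ffun W -> A} -> K), #|K| = m /\ proper cl c) <->
  (chromatic_number (solvability_graph cl (A := A)) <= m)%N.
Proof.
move=> hcl; split=> [[K [c [<- cP]]]|].
  apply: (chromatic_number_le (c := c)) => x y; rewrite solvability_graphE //.
  by apply: contraNneq => /cP.
have [c cP] := chromatic_number_colouring (solvability_graph_irr (A := A) hcl).
move=> le; exists 'I_m, (fun x => widen_ord le (c x)).
split; first exact: card_ord.
move=> x y /(congr1 val) /= /val_inj eqc.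
have:= cP x y; rewrite solvability_graphE // eqc eqxx.
by case: (_ \subset _) => // /(_ isT).
Qed.

(** * The bidirectional union: closure axioms, closed sets and rank *)

Section BidirectionalUnion.
Variables (V1 V2 : finType).
Variables (cl1 : {set V1} -> {set V1}) (cl2 : {set V2} -> {set V2}).
Hypotheses (hcl1 : closure_operator cl1) (hcl2 : closure_operator cl2).
Implicit Types X Y : {set V1 + V2}.
Local Notation cl12 := (bidirectional_union cl1 cl2).
Local Notation pr1 X := (inl @^-1: X : {set V1}).
Local Notation pr2 X := (inr @^-1: X : {set V2}).

Let inl_inj : injective (@inl V1 V2). Proof. by move=> ? ? []. Qed.
Let inr_inj : injective (@inr V1 V2). Proof. by move=> ? ? []. Qed.

Let inl_imset (D : {set V1}) (E : {set V2}) v :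
  (inl v \in inl @: D :|: inr @: E) = (v \in D).
Proof.
rewrite inE mem_imset //; case: imsetP => [[//]|_]; exact: orbF.
Qed.

Let inr_imset (D : {set V1}) (E : {set V2}) v :
  (inr v \in inl @: D :|: inr @: E) = (v \in E).
Proof. by rewrite inE [X in _ || X]mem_imset //; case: imsetP => [[//]|_]. Qed.

Let pr1_imset (D : {set V1}) (E : {set V2}) : pr1 (inl @: D :|: inr @: E) = D.
Proof. by apply/setP=> v; rewrite inE inl_imset. Qed.

Let pr2_imset (D : {set V1}) (E : {set V2}) : pr2 (inl @: D :|: inr @: E) = E.
Proof. by apply/setP=> v; rewrite inE inr_imset. Qed.

(** Coordinatewise, the three cases of the definition merge into one formula: a half gains points
    only when the other half is full. *)
Lemma bidirectional_union_inl X v :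
  (inl v \in cl12 X) =
    (inl v \in X) || (pr2 X == [set: V2]) && (v \in cl1 (pr1 X)).
Proof.
case: hcl1 => ext _ _; rewrite /bidirectional_union.
case: ifP => [/eqP/setP X1|_].
  by have:= X1 v; rewrite inl_imset !inE => ->.
case: ifP => _; rewrite inl_imset ?inE ?orbF //=.
by have /implyP := subsetP (ext (pr1 X)) v; rewrite inE; case: (inl v \in X).
Qed.

Lemma bidirectional_union_inr X v :
  (inr v \in cl12 X) =
    (inr v \in X) || (pr1 X == [set: V1]) && (v \in cl2 (pr2 X)).
Proof.
case: hcl2 => ext _ _; rewrite /bidirectional_union.
case: ifP => [_|_].
  have /implyP := subsetP (ext (pr2 X)) v; rewrite inr_imset inE /=.
  by case: (inr v \in X).
case: ifP => [/eqP/setP X2|_]; rewrite inr_imset !inE ?orbF //=.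
by have:= X2 v; rewrite !inE => ->.
Qed.

Lemma closure_bidirectional_union : closure_operator cl12.
Proof.
case: (hcl1) (hcl2) => ext1 mono1 idem1 [ext2 mono2 idem2].
split=> [X|X Y sXY|X].
- apply/subsetP=> -[v|v] vX.
    by rewrite bidirectional_union_inl vX.
  by rewrite bidirectional_union_inr vX.
- have s1 : pr1 X \subset pr1 Y by apply: preimsetS.
  have s2 : pr2 X \subset pr2 Y by apply: preimsetS.
  apply/subsetP=> -[v|v].
    rewrite !bidirectional_union_inl => /orP[/(subsetP sXY)->//|].
    case/andP=> /eqP X2 /(subsetP (mono1 _ _ s1))->.
    by rewrite -subTset -X2 s2 orbT.
  rewrite !bidirectional_union_inr => /orP[/(subsetP sXY)->//|].
  case/andP=> /eqP X1 /(subsetP (mono2 _ _ s2))->.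
  by rewrite -subTset -X1 s1 orbT.
- apply/setP=> -[v|v].
    rewrite bidirectional_union_inl; apply/orb_idr=> /andP[].
    rewrite bidirectional_union_inl => /eqP/setP full.
    (* If the second half becomes full only after closing, then the first half of [X] was already
       full and contains [v]. Otherwise idempotence of [cl1] applies. *)
    have [X2|X2] := boolP (pr2 X == setT); last first.
      suff /eqP/setP/(_ v): pr1 X == setT by rewrite !inE => ->.
      apply: contraR X2 => X1; apply/eqP/setP=> w; have:= full w.
      by rewrite !inE bidirectional_union_inr (negbTE X1) orbF.
    suff ->: pr1 (cl12 X) = cl1 (pr1 X) by rewrite idem1 orbC => ->.
    apply/setP=> w; rewrite inE bidirectional_union_inl X2 /=.
    by apply/orb_idl; have:= subsetP (ext1 (pr1 X)) w; rewrite inE.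
  rewrite bidirectional_union_inr; apply/orb_idr=> /andP[].
  rewrite bidirectional_union_inr => /eqP/setP full.
  have [X1|X1] := boolP (pr1 X == setT); last first.
    suff /eqP/setP/(_ v): pr2 X == setT by rewrite !inE => ->.
    apply: contraR X1 => X2; apply/eqP/setP=> w; have:= full w.
    by rewrite !inE bidirectional_union_inl (negbTE X2) orbF.
  suff ->: pr2 (cl12 X) = cl2 (pr2 X) by rewrite idem2 orbC => ->.
  apply/setP=> w; rewrite inE bidirectional_union_inr X1 /=.
  by apply/orb_idl; have:= subsetP (ext2 (pr2 X)) w; rewrite inE.
Qed.

Lemma bidirectional_union_closed X :
  (cl12 X \subset X) =
    ((pr1 X == [set: V1]) ==> (cl2 (pr2 X) \subset pr2 X)) &&
    ((pr2 X == [set: V2]) ==> (cl1 (pr1 X) \subset pr1 X)).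
Proof.
apply/subsetP/andP=> [sub|[/implyP sub2 /implyP sub1] [v|v]].
  split; apply/implyP=> full; apply/subsetP=> v vcl; rewrite inE; apply: sub.
    by rewrite bidirectional_union_inr full vcl orbT.
  by rewrite bidirectional_union_inl full vcl orbT.
- rewrite bidirectional_union_inl => /orP[//|/andP[/sub1/subsetP sub /sub]].
  by rewrite inE.
- rewrite bidirectional_union_inr => /orP[//|/andP[/sub2/subsetP sub /sub]].
  by rewrite inE.
Qed.

Lemma card_sum_set X : #|X| = (#|pr1 X| + #|pr2 X|)%N.
Proof.
rewrite -sum1_card big_sumType /= -!sum1_card.
by congr addn; apply: eq_bigl => v; rewrite inE.
Qed.

(** A spanning set must contain one half entirely, since otherwise neither half can grow to full
    size first; its trace on the other half must then span that half. *)
Lemma rank_bidirectional_union :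
  rank cl12 = minn (#|V1| + rank cl2) (#|V2| + rank cl1).
Proof.
have hcl := closure_bidirectional_union.
apply/eqP; rewrite eqn_leq; apply/andP; split.
  rewrite leq_min; apply/andP; split.
    have [b clb <-] := rank_basis hcl2.
    have <- : #|inl @: [set: V1] :|: inr @: b| = (#|V1| + #|b|)%N.
      by rewrite card_sum_set pr1_imset pr2_imset cardsT.
    apply: rank_le_card; apply/setP=> -[v|v].
      by rewrite bidirectional_union_inl inl_imset !inE.
    by rewrite bidirectional_union_inr pr1_imset pr2_imset eqxx clb !inE orbT.
  have [b clb <-] := rank_basis hcl1.
  have <- : #|inl @: b :|: inr @: [set: V2]| = (#|V2| + #|b|)%N.
    by rewrite card_sum_set pr1_imset pr2_imset cardsT addnC.
  apply: rank_le_card; apply/setP=> -[v|v].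
    by rewrite bidirectional_union_inl pr1_imset pr2_imset eqxx clb !inE orbT.
  by rewrite bidirectional_union_inr inr_imset !inE.
have [b /setP clb <-] := rank_basis hcl.
rewrite card_sum_set geq_min.
have [b2|b2] := boolP (pr2 b == setT).
  apply/orP; right; rewrite (eqP b2) cardsT addnC leq_add2r.
  apply: rank_le_card; apply/setP=> v.
  have:= clb (inl v); rewrite bidirectional_union_inl b2 !inE.
  case/orP=> // vb; case: hcl1 => ext _ _.
  by apply: (subsetP (ext _)); rewrite inE.
have b1 : pr1 b == setT.
  apply: contraR b2 => b1; apply/eqP/setP=> v; have:= clb (inr v).
  by rewrite bidirectional_union_inr (negbTE b1) orbF !inE.
rewrite (eqP b1) cardsT leq_add2l; apply/orP; left.
apply: rank_le_card; apply/setP=> v.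
have:= clb (inr v); rewrite bidirectional_union_inr b1 !inE.
case/orP=> // vb; case: hcl2 => ext _ _.
by apply: (subsetP (ext _)); rewrite inE.
Qed.

(** * Words on the disjoint union, and solvability of the union *)

Variable A : finType.
Implicit Types (x : {ffun V1 -> A}) (y : {ffun V2 -> A}).

Definition join (p : {ffun V1 -> A} * {ffun V2 -> A}) : {ffun V1 + V2 -> A} :=
  [ffun v => match v with inl v1 => p.1 v1 | inr v2 => p.2 v2 end].

Lemma join_bij : bijective join.
Proof.
exists (fun z : {ffun V1 + V2 -> A} =>
  ([ffun v => z (inl v)], [ffun v => z (inr v)])) => [[x y]|z].
  by congr pair; apply/ffunP=> v; rewrite !ffunE.
by apply/ffunP=> -[v|v]; rewrite !ffunE.
Qed.

Lemma agreeT (W : finType) (x y : {ffun W -> A}) :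
  (agree x y == [set: W]) = (x == y).
Proof.
apply/eqP/eqP=> [/setP full|->]; last by apply/setP=> v; rewrite !inE eqxx.
by apply/ffunP=> v; have:= full v; rewrite !inE => /eqP.
Qed.

(* The solvability graph of the bidirectional union is the Cartesian product
   of the two solvability graphs. *)
Lemma agree_join_closed x y x' y' :
  (cl12 (agree (join (x, y)) (join (x', y')))
     \subset agree (join (x, y)) (join (x', y'))) =
  ((x == x') ==> (cl2 (agree y y') \subset agree y y')) &&
  ((y == y') ==> (cl1 (agree x x') \subset agree x x')).
Proof.
rewrite bidirectional_union_closed.
have ->: pr1 (agree (join (x, y)) (join (x', y'))) = agree x x'.
  by apply/setP=> v; rewrite !inE !ffunE.
have ->: pr2 (agree (join (x, y)) (join (x', y'))) = agree y y'.
  by apply/setP=> v; rewrite !inE !ffunE.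
by rewrite !agreeT.
Qed.

Lemma sum_fibres1 (S : {set {ffun V1 + V2 -> A}}) :
  (\sum_x #|[set y | join (x, y) \in S]| = #|S|)%N.
Proof.
have bij : {on [pred z | z \in S], bijective join} by exact: onW_bij join_bij.
rewrite -(on_card_preimset bij) -sum1_card.
under eq_bigr do rewrite -sum1_card.
rewrite pair_big_dep /=; apply: eq_bigl => -[x y] /=.
by rewrite !inE.
Qed.

Lemma sum_fibres2 (S : {set {ffun V1 + V2 -> A}}) :
  (\sum_y #|[set x | join (x, y) \in S]| = #|S|)%N.
Proof.
rewrite -sum_fibres1; under eq_bigr do rewrite -sum1_card.
under [RHS]eq_bigr do rewrite -sum1_card.
rewrite (exchange_big_dep predT) //=; apply: eq_bigr => x _.
by apply: eq_bigl => y; rewrite !inE.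
Qed.

(** Words of one fibre agree on all of [V1], where the Cartesian product reduces to the second
    graph. *)
Lemma compatible_fibre1 (S : {set {ffun V1 + V2 -> A}}) x :
  compatible cl12 S -> compatible cl2 [set y | join (x, y) \in S].
Proof.
move=> cS y y'; rewrite !inE => /cS/[apply].
by rewrite agree_join_closed eqxx => /andP[].
Qed.

Lemma compatible_fibre2 (S : {set {ffun V1 + V2 -> A}}) y :
  compatible cl12 S -> compatible cl1 [set x | join (x, y) \in S].
Proof.
move=> cS x x'; rewrite !inE => /cS/[apply].
by rewrite agree_join_closed eqxx => /andP[].
Qed.

Hypothesis A_gt0 : (0 < #|A|)%N.
Hypothesis le_codim : (#|V2| + rank cl1 <= #|V1| + rank cl2)%N.

Lemma bidirectional_union_solvable (K : finType)
    (c1 : {ffun V1 -> A} -> K) (c2 : {ffun V2 -> A} -> K) :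
    #|K| = (#|A| ^ (#|V1| - rank cl1))%N -> proper cl1 c1 -> proper cl2 c2 ->
  solvable_over cl12 A.
Proof.
move=> eqK c1P c2P.
apply/(solvableP closure_bidirectional_union A_gt0).
pose S := [set join p | p in [set p | c1 p.1 == c2 p.2]].
have memS x y : (join (x, y) \in S) = (c1 x == c2 y).
  by rewrite mem_imset ?inE //; exact: bij_inj join_bij.
exists S.
  move=> _ _ /imsetP[[x y] + ->] /imsetP[[x' y'] + ->].
  rewrite !inE agree_join_closed /= => /eqP eqc /eqP eqc'.
  (* Words of [S] with one equal component share its colour, so their other components have equal
     colours too. *)
  apply/andP; split; apply/implyP=> /eqP eqx.
    by apply: c2P; rewrite -eqc -eqc' eqx.
  by apply: c1P; rewrite eqc eqc' eqx.
(* Over each [y] the fibre of [S] is a full colour class of [c1], of size q^r1; there are q^n2 such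
   fibres. *)
rewrite -sum_fibres2 rank_bidirectional_union (minn_idPr le_codim).
under eq_bigr => y _.
  have -> : [set x | join (x, y) \in S] = [set x | c1 x == c2 y].
    by apply/setP=> x; rewrite !inE memS.
  rewrite (proper_fibre_card hcl1 eqK c1P).
  over.
by rewrite sum_nat_const card_ffun expnD.
Qed.

Lemma bidirectional_union_fibres : solvable_over cl12 A ->
  solvable_over cl1 A /\
  exists2 S : {set {ffun V2 -> A}}, compatible cl2 S &
    (#|A| ^ (#|V2| + rank cl1) <= #|A| ^ #|V1| * #|S|)%N.
Proof.
move/(solvableP closure_bidirectional_union A_gt0) => [S cS].
rewrite rank_bidirectional_union (minn_idPr le_codim) => eqS.
have /card_gt0P[a _] := A_gt0.
split.
  apply/(solvableP hcl1 A_gt0).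
  (* Any fibre would serve: the total size of [S] forces them all to have q^r1 words. *)
  exists [set x | join (x, [ffun=> a]) \in S]; first exact: compatible_fibre2.
  apply: (sum_nat_eq_bound (F := fun y => #|[set x | join (x, y) \in S]|)).
    by move=> y; apply: (compatible_card hcl1); apply: compatible_fibre2.
  by rewrite sum_fibres2 eqS card_ffun expnD.
(* A largest fibre is at least as large as the average one. *)
have [x _ maxx] := @arg_maxnP _ [ffun=> a] predT
  (fun x => #|[set y | join (x, y) \in S]|) isT.
exists [set y | join (x, y) \in S]; first exact: compatible_fibre1.
rewrite -eqS -sum_fibres1 -card_ffun -sum_nat_const.
by apply: leq_sum => x' _; apply: maxx.
Qed.

End BidirectionalUnion.

(** * Translating logarithmic inequalities into inequalities between powers *)

Section Log.
Variables (R : realType) (q : nat).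
Hypothesis q_gt1 : (1 < q)%N.

Lemma ln_natX n : ln ((q ^ n)%:R : R) = n%:R * ln q%:R.
Proof. by rewrite natrX lnXn ?ltr0n 1?ltnW // mulr_natl. Qed.

Lemma ln_nat_gt0 : 0 < ln q%:R :> R.
Proof. by rewrite ln_gt0 // ltr1n. Qed.

Lemma ler_ln_nat m n : (0 < m)%N -> (0 < n)%N ->
  (ln (m%:R : R) <= ln n%:R) = (m <= n)%N.
Proof. by move=> m0 n0; rewrite ler_ln ?posrE ?ltr0n // ler_nat. Qed.

Lemma log_le k n : (0 < k)%N -> (log R q k <= n%:R) = (k <= q ^ n)%N.
Proof.
move=> k0; rewrite /log ler_pdivrMr ?ln_nat_gt0 // -ln_natX ler_ln_nat //.
by rewrite expn_gt0 ltnW.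
Qed.

(** Moving [n] across avoids a natural exponent [m - n], which would be wrong when [m < n]. *)
Lemma le_log_sub k m n : (0 < k)%N ->
  (m%:R - n%:R <= log R q k) = (q ^ m <= q ^ n * k)%N.
Proof.
move=> k0; have qX0 l : (0 < q ^ l)%N by rewrite expn_gt0 ltnW.
rewrite /log ler_pdivlMr ?ln_nat_gt0 // mulrBl lerBlDl -!ln_natX.
rewrite -lnM ?posrE ?ltr0n //.
by rewrite -natrM ler_ln_nat // muln_gt0 qX0.
Qed.

End Log.

(** * The guessing number as a maximum over compatible sets *)

Section GuessingNumber.
Variables (R : realType) (W A : finType) (cl : {set W} -> {set W}).
Hypotheses (hcl : closure_operator cl) (A_gt1 : (1 < #|A|)%N).

Lemma guessing_number_ge (S : {set {ffun W -> A}}) : S != set0 ->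
  compatible cl S -> log R #|A| #|S| <= guessing_number R cl A.
Proof.
move=> S0 cS; have [h [cf <- _]] := compatible_coding hcl cS S0.
rewrite -Im_fun /guessing_number.
apply: (bigmax_sup (fun_parts h, fun_labels h)) => //=.
by rewrite cf labelling_fun.
Qed.

Lemma guessing_number_attained :
  exists2 S : {set {ffun W -> A}}, S != set0 /\ compatible cl S &
    guessing_number R cl A = log R #|A| #|S|.
Proof.
rewrite /guessing_number; elim/big_ind: _ => [|s t Ss St|[f P] /andP[cf lfP]].
(* The default value 0 is the logarithm of the size of a one-word set. *)
- have /card_gt0P[a _] := ltnW A_gt1.
  exists [set [ffun=> a]]; last by rewrite cards1 /log ln1 mul0r.
  split; last exact: compatible1.
  by apply/set0Pn; exists [ffun=> a]; apply: set11.
- by rewrite /Num.max; case: ifP.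
- exists (Defs.Im P) => //.
  split; last exact: coding_function_compatible cf lfP.
  have /card_gt0P[a _] := ltnW A_gt1.
  have [x xP] := coding_function_label [tuple of nseq _ a] cf lfP.
  by apply/set0Pn; exists x; apply/ImP; exists [tuple of nseq _ a].
Qed.

End GuessingNumber.

(** * The chain of implications and the case of equal codimensions *)

Theorem corollary4 (R : realType) (V1 V2 : finType)
    (cl1 : {set V1} -> {set V1}) (cl2 : {set V2} -> {set V2})
    (hcl1 : closure_operator cl1) (hcl2 : closure_operator cl2)
    (n1 n2 r1 r2 : nat)
    (hn1 : n1 = #|V1|) (hn2 : n2 = #|V2|)
    (hr1 : r1 = rank cl1) (hr2 : r2 = rank cl2)
    (hnr : n2%:R - r2%:R <= n1%:R - r1%:R :> R)
    (A : finType) (hA : (2 <= #|A|)%N) :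
  [/\ (* (a) implies (b) *)
      solvable_over cl1 A /\ solvable_over cl2 A ->
      solvable_over cl1 A /\ log_chromatic_number R cl2 A <= n1%:R - r1%:R,
      (* (b) implies (c) *)
      solvable_over cl1 A /\ log_chromatic_number R cl2 A <= n1%:R - r1%:R ->
      solvable_over (bidirectional_union cl1 cl2) A,
      (* (c) implies (d) *)
      solvable_over (bidirectional_union cl1 cl2) A ->
      solvable_over cl1 A /\ n2%:R - n1%:R + r1%:R <= guessing_number R cl2 A &
      n1%:R - r1%:R = n2%:R - r2%:R :> R ->
      (solvable_over (bidirectional_union cl1 cl2) A <->
       solvable_over cl1 A /\ solvable_over cl2 A)].
Proof.
subst n1 n2 r1 r2; have A_gt0 : (0 < #|A|)%N := ltnW hA.
have r1V := rank_le cl1; have r2V := rank_le cl2.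
have codim : (#|V2| - rank cl2 <= #|V1| - rank cl1)%N.
  by move: hnr; rewrite -!natrB // ler_nat.
have le_codim : (#|V2| + rank cl1 <= #|V1| + rank cl2)%N.
  by move: codim r1V r2V; lia.
have chi_gt0 : (0 < chromatic_number (solvability_graph cl2 (A := A)))%N.
  have [c _] :=
    chromatic_number_colouring (solvability_graph_irr (A := A) hcl2).
  have /card_gt0P[a _] := A_gt0.
  exact: leq_ltn_trans (leq0n _) (ltn_ord (c [ffun=> a])).
have ab : solvable_over cl1 A /\ solvable_over cl2 A ->
    solvable_over cl1 A /\
    log_chromatic_number R cl2 A <= #|V1|%:R - (rank cl1)%:R.
  case=> sol1 sol2; split=> //.
  rewrite -natrB // /log_chromatic_number log_le //.
  have := solvable_proper hcl2 A_gt0 sol2.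
  move/(chromatic_number_proper _ _ hcl2)/leq_trans; apply.
  by rewrite leq_exp2l.
have bc : solvable_over cl1 A /\
    log_chromatic_number R cl2 A <= #|V1|%:R - (rank cl1)%:R ->
    solvable_over (bidirectional_union cl1 cl2) A.
  case=> sol1; rewrite -natrB // /log_chromatic_number log_le //.
  move/(chromatic_number_proper _ _ hcl2) => [K2 [c2 [eqK2 c2P]]].
  have [K1 [c1 [eqK1 c1P]]] := solvable_proper hcl1 A_gt0 sol1.
  (* Both palettes have q^(n1 - r1) colours, so [c1] can be recoloured with [K2]. *)
  have eqK : #|K1| = #|K2| by rewrite eqK1.
  apply: (@bidirectional_union_solvable _ _ _ _ hcl1 hcl2 _ A_gt0 le_codim K2
    (fun x => enum_val (cast_ord eqK (enum_rank (c1 x)))) c2) => //.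
  by move=> x y /enum_val_inj/cast_ord_inj/enum_rank_inj; apply: c1P.
have cd : solvable_over (bidirectional_union cl1 cl2) A ->
    solvable_over cl1 A /\
    #|V2|%:R - #|V1|%:R + (rank cl1)%:R <= guessing_number R cl2 A.
  move/(bidirectional_union_fibres hcl1 hcl2 A_gt0 le_codim).
  case=> sol1 [S cS leS]; split=> //.
  (* An empty [S] would bound a positive power of [#|A|] by zero. *)
  have S_gt0 : (0 < #|S|)%N.
    move: leS; case: #|S| => //.
    by rewrite muln0 leqn0 expn_eq0 -leqn0 leqNgt A_gt0.
  apply: le_trans (guessing_number_ge R hcl2 _ cS); last by rewrite -card_gt0.
  by rewrite addrAC -natrD le_log_sub.
split=> // eq_codim; split=> [/cd[sol1 le_g]|/ab/bc//]; split=> //.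
(* With equal codimensions the bound in (d) reads g >= r2, so a set attaining the guessing number
   has the q^r2 words that solvability asks for. *)
have [S [S0 cS] eqg] := guessing_number_attained R cl2 hA.
apply/(solvableP hcl2 A_gt0); exists S => //.
apply/eqP; rewrite eqn_leq compatible_card //=.
have: (rank cl2)%:R - 0%:R <= log R #|A| #|S|.
  rewrite -eqg; apply: le_trans le_g; lra.
by rewrite le_log_sub ?card_gt0 // expn0 mul1n.
Qed.
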